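(* Let $K$ be a field and let $\mathcal{A}=\{\mathbf{m}^{(1)},\dots,\mathbf{m}^{(s)}\}\subset \mathbb{Z}^n$ be a configuration. For each positive integer $d$ let $$\mathcal{A}^{(d)}=\{a_1\mathbf{m}^{(1)}+\dots+a_s\mathbf{m}^{(s)}\mid (a_1,\dots,a_s)\in\mathbb{N}^s,\ a_1+\dots+a_s=d\}.$$ Then, for all sufficiently large $d$, the toric ideal $P_{\mathcal{A}^{(d)}}$ admits a quadratic Gröbner basis.
   Context: $\mathbb{N}=\{0,1,2,\dots\}$. A finite collection $\mathcal{A}=\{\mathbf{m}^{(1)},\dots,\mathbf{m}^{(s)}\}\subset\mathbb{Z}^n$, $\mathbf{m}^{(i)}=(m^{(i)}_1,\dots,m^{(i)}_n)$, is called a configuration if there exists a vector $0\neq\boldsymbol{\lambda}=(\lambda_1,\dots,\lambda_n)\in\mathbb{Q}^n$ with $\sum_j\lambda_j m^{(i)}_j=1$ for all $i$. (If $\mathcal{A}$ is a configuration, so is $\mathcal{A}^{(d)}$, via $\boldsymbol\lambda/d$.) For a configuration $\mathcal{A}$ with $s$ elements, the toric ideal $P_{\mathcal{A}}$ is the kernel of the $K$-algebra homomorphism $\phi_{\mathcal{A}}:K[y_1,\dots,y_s]\to K[z_1^{\pm1},\dots,z_n^{\pm1}]$, $y_i\mapsto \mathbf{z}^{\mathbf{m}^{(i)}}=\prod_{j=1}^n z_j^{m^{(i)}_j}$; it is a homogeneous ideal for the standard grading. Thus $P_{\mathcal{A}^{(d)}}$ is the kernel of the analogous map from the polynomial ring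 over $K$ with one variable for each element of $\mathcal{A}^{(d)}$. A homogeneous ideal admits a quadratic Gröbner basis if, with respect to some term order, it has a Gröbner basis consisting of homogeneous polynomials of degree at most $2$. *)

(* Defs.v *)
From HB Require Import structures.
From mathcomp Require Import all_boot all_order all_algebra.
From mathcomp Require Import fraction finmap.
From mathcomp.multinomials Require Import mpoly.

Set Implicit Arguments.
Unset Strict Implicit.
Unset Printing Implicit Defensive.

Import GRing.Theory.

Local Open Scope ring_scope.

Definition is_configuration (n : nat) (A : {fset 'rV[int]_n}) : Prop :=
  exists lambda : 'rV[rat]_n,
    lambda != 0 /\
    forall m, m \in A -> \sum_(j < n) lambda 0 j * (m 0 j)%:~R = 1.

(* The coefficients a_i are natural numbers of sum d, hence at most d, so that
   ranging over 'I_d.+1 loses nothing. *)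
Definition dilate (n : nat) (A : {fset 'rV[int]_n}) (d : nat) :
    {fset 'rV[int]_n} :=
  [fset \sum_(i : A) val i *+ a i
     | a : {ffun A -> 'I_d.+1}
         in [pred a : {ffun A -> 'I_d.+1} | (\sum_i a i == d)%N]]%fset.

Section Toric.
Variables (K : fieldType) (n : nat).

(* The Laurent polynomial ring K[z_1^{+-1}, ..., z_n^{+-1}] is regarded as a
   subring of its fraction field K(z_1, ..., z_n). *)
Definition laurent_monomial (m : 'rV[int]_n) : {fraction {mpoly K[n]}} :=
  \prod_(j < n) (tofrac 'X_j) ^ (m 0 j).

(* The variables y_i are numbered by an enumeration of A. *)
Definition toric_map (A : {fset 'rV[int]_n}) (p : {mpoly K[#|` A|]}) :
    {fraction {mpoly K[n]}} :=
  mmap (@tofrac {mpoly K[n]} \o @mpolyC n K)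
       (fun i : 'I_(#|` A|) => laurent_monomial (enum_fset A)`_i) p.

Definition toric_ideal (A : {fset 'rV[int]_n}) (p : {mpoly K[#|` A|]}) : Prop :=
  toric_map p = 0.

End Toric.

Arguments toric_map K {n} A p.
Arguments toric_ideal K {n} A p.

Definition ideal_generated (R : comNzRingType) (S : R -> Prop) (x : R) : Prop :=
  exists r : seq (R * R),
    (forall c, c \in r -> S c.2) /\ x = \sum_(c <- r) c.1 * c.2.

Definition is_term_order (N : nat) (le : rel 'X_{1..N}) : Prop :=
  [/\ antisymmetric le, transitive le, total le,
      forall m, le 0%MM m
    & forall m m1 m2, le m1 m2 -> le (m1 + m)%MM (m2 + m)%MM].

Section Groebner.
Variables (K : fieldType) (N : nat) (le : rel 'X_{1..N}).

(* No monomial is initial in the zero polynomial. *)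
Definition is_initial_monomial (p : {mpoly K[N]}) (m : 'X_{1..N}) : Prop :=
  m \in msupp p /\ forall m', m' \in msupp p -> le m' m.

Definition initial_ideal (S : {mpoly K[N]} -> Prop) : {mpoly K[N]} -> Prop :=
  ideal_generated
    (fun q => exists p m, [/\ S p, is_initial_monomial p m & q = 'X_[m]]).

Definition is_groebner_basis (I : {mpoly K[N]} -> Prop)
    (G : seq {mpoly K[N]}) : Prop :=
  (forall g, g \in G -> I g) /\
  (forall q, initial_ideal (fun g => g \in G) q <-> initial_ideal I q).

End Groebner.

Definition admits_quadratic_groebner_basis (K : fieldType) (N : nat)
    (I : {mpoly K[N]} -> Prop) : Prop :=
  exists (le : rel 'X_{1..N}) (G : seq {mpoly K[N]}),
    [/\ is_term_order le, is_groebner_basis le I G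
      & forall g, g \in G -> exists2 e : nat, (e <= 2)%N & g \is e.-homog].

(* Main.v *)
Require Import Defs.
From mathcomp Require Import all_boot all_order all_algebra.
From mathcomp Require Import finmap fraction perm zify.
From mathcomp.multinomials Require Import mpoly.
From Stdlib Require Import Classical.

(** Fix the order [<=%O] on the monomials of K[x_1, ..., x_s], one variable for
    each element of A, and call a monomial standard when it is least among the
    monomials with the same image. The variables of the toric ring of A^(d)
    correspond to the standard monomials of degree d, so a monomial w in these
    variables expands to a product M of degree d |w|. Order the w first by M,
    then by a reverse lexicographic order in which the variables of small
    weight come first, where the weight sum_i (s e_i^2 + 2 i e_i) is smallest
    for the divisor of M of degree d that takes the first copy of each x_i,
    then the second copy of each x_i, and so on, until d factors are taken.
    Whether v is this least divisor of v r depends only on the support of r, so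
    it can be tested on pairs of variables: if no quadratic binomial reduces w,
    then some variable of w is the least divisor v of M. When d is large, v has
    at least min(M_i, b) copies of every x_i, where b is the bound given by
    Dickson's lemma such that nonstandardness of M is seen on the truncation of
    M at b; as v is standard, so is M. Hence w is least among the monomials with
    its image, and the quadratic binomials form a Groebner basis. *)

Set Implicit Arguments.
Unset Strict Implicit.
Unset Printing Implicit Defensive.

Import Order.TTheory GRing.Theory.

(** * Dickson's lemma *)

Lemma fin_uniform_bound (T : finType) (P : T -> nat -> Prop) :
    (forall x h h', h <= h' -> P x h -> P x h') ->
    (forall x, exists h, P x h) ->
  exists H, forall x, P x H.
Proof.
move=> Pmono /fin_all_exists [h hP].
by exists (\max_x h x) => x; apply: Pmono (hP x); apply: leq_bigmax.
Qed.

(** Induction on [s], slicing [U] by the value of the last coordinate. Sequences that vanish from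
    [s] on stand for vectors, which spares any reindexing. *)
Lemma upset_truncation_nat (s : nat) (U : (nat -> nat) -> Prop) :
    (forall f g, (forall i, f i <= g i) -> U f -> U g) ->
  exists b, forall f, (forall i, s <= i -> f i = 0) -> U f ->
    U (fun i => minn (f i) b).
Proof.
elim: s U => [|s IHs] U Umono.
  exists 0 => f f0; apply: Umono => i; by rewrite f0.
pose slice h (f : nat -> nat) := U (fun i => if i == s then h else f i).
have slice_mono h h' f g : h <= h' -> (forall i, i != s -> f i <= g i) ->
    slice h f -> slice h' g.
  move=> hh fg; apply: Umono => i /=; case: eqVneq => // /fg //.
have [b bP] : exists b, forall f, (forall i, s <= i -> f i = 0) ->
    (exists h, slice h f) -> exists h, slice h (fun i => minn (f i) b).
  apply: (IHs (fun f => exists h, slice h f)) => f g fg [h hf]; exists h.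
  exact: slice_mono hf.
pose box (f : {ffun 'I_s -> 'I_b.+1}) i : nat :=
  if (insub i : option 'I_s) is Some k then f k else 0.
(* Only finitely many vectors are bounded by [b], so one height [H] of the last coordinate serves
   all those that lie in some slice. *)
have [H HP] : exists H, forall f, (exists h, slice h (box f)) -> slice H (box f).
  apply: (fin_uniform_bound (P := fun f H => (exists h, slice h (box f)) -> slice H (box f))).
    by move=> f h h' hh hP /hP; apply: slice_mono.
  move=> f; have [[h hf]|nh] := classic (exists h, slice h (box f)).
    by exists h.
  by exists 0 => /nh.
have [b' b'P] : exists b', forall (h : 'I_H.+1) f, (forall i, s <= i -> f i = 0) ->
    slice h f -> slice h (fun i => minn (f i) b').
  apply: (fin_uniform_bound (P := fun (h : 'I_H.+1) b' =>
    forall f, (forall i, s <= i -> f i = 0) ->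
    slice h f -> slice h (fun i => minn (f i) b'))).
    move=> h c c' cc cP f f0 /(cP _ f0); apply: slice_mono => // i _.
    by rewrite leq_min geq_minl (leq_trans (geq_minr _ _)).
  by move=> h; apply: IHs => f g fg; apply: slice_mono.
exists (maxn (maxn b b') H) => f f0 Uf.
pose f' i := if i == s then 0 else f i.
have f'0 i : s <= i -> f' i = 0.
  by rewrite /f'; case: eqVneq => // ? ?; apply: f0; lia.
have Uf' : slice (f s) f'.
  by apply: Umono Uf => i; rewrite /f'; case: eqVneq => // ->.
(* Up to [H], the slice containing [f] is truncated at [b']. Above [H], the truncated last
   coordinate is still at least [H], and slice [H] applies. *)
have [fs|fs] := leqP (f s) H.
  have := b'P (Ordinal (fs : f s < H.+1)) f' f'0 Uf'; apply: Umono => i.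
  by rewrite /f' /=; case: eqVneq => [->|_]; lia.
have [h hP] : exists h, slice h (fun i => minn (f' i) b).
  by apply: bP => //; exists (f s).
pose g := [ffun i : 'I_s => inord (minn (f' i) b) : 'I_b.+1].
have gE i : box g i = minn (f' i) b.
  rewrite /box; case: insubP => [k _ ki|].
    by rewrite /= ffunE inordK ?ki // ltnS geq_minr.
  by rewrite -leqNgt => /f'0 ->; rewrite min0n.
have : slice H (box g).
  apply: HP; exists h; apply: slice_mono hP => // i _; by rewrite gE.
apply: Umono => i; rewrite gE /f'.
by case: eqVneq => [->|_]; lia.
Qed.

Lemma upset_truncation (s : nat) (U : 'X_{1..s} -> Prop) :
    (forall m m', (m <= m')%MM -> U m -> U m') ->
  exists b, forall m, U m -> U [multinom minn (m i) b | i < s].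
Proof.
move=> Umono; pose mk (f : nat -> nat) := [multinom f i | i < s].
have [|b bP] := @upset_truncation_nat s (fun f => U (mk f)).
  by move=> f g fg; apply: Umono; apply/mnm_lepP => i; rewrite !mnmE.
exists b => m Um.
pose f i := oapp m 0 (insub i).
have fE (i : 'I_s) : f i = m i by rewrite /f valK.
have : U (mk (fun i => minn (f i) b)).
  apply: bP; last by apply: Umono Um; apply/mnm_lepP => i; rewrite mnmE fE.
  by move=> i si; rewrite /f insubF //; lia.
by apply: Umono; apply/mnm_lepP => i; rewrite !mnmE fE.
Qed.

(** * The weight *)

(** The [h]-th copy of a variable adds [2 (s h + i) - s] to the weight. If [t] separates the first
    [y] copies from the next one, going from [y] to [x] copies costs at least [(2 t - s) (x - y)],
    and more if [x > y]. Terms are moved across to avoid truncated subtraction. *)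
Lemma weight_exchange s i t x y :
    (0 < y -> s * y + i <= t) -> (y < x -> t < s * y.+1 + i) ->
  s * (y * y) + 2 * (i * y) + (2 * t * x + s * y) + (y < x)
    <= s * (x * x) + 2 * (i * x) + (2 * t * y + s * x).
Proof.
move=> h1 h2; have [yx|] := ltnP y x.
  have {}h2 := h2 yx; have -> : x = y + (x - y).-1.+1 by lia.
  move: (x - y).-1 => z.
  have h3 : z.+1 * t.+1 <= z.+1 * (s * y.+1 + i) by rewrite leq_mul2l h2 orbT.
  have h4 : s * z.+1 <= s * z.+1 * z.+1 by rewrite leq_pmulr.
  nia.
rewrite leq_eqVlt => /orP[/eqP ->|xy]; first by lia.
have {}h1 : s * y + i <= t by apply: h1; lia.
move: h1; have -> : y = x + (y - x).-1.+1 by lia.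
move: (y - x).-1 => z h1.
have h3 : z.+1 * (s * (x + z.+1) + i) <= z.+1 * t by rewrite leq_mul2l h1 orbT.
have h4 : s * z.+1 <= s * z.+1 * z.+1 by rewrite leq_pmulr.
nia.
Qed.

Section Weight.
Variable s : nat.
Implicit Types u v r : 'X_{1..s}.

(** The [h]-th copy of [x_i] contributes [2 (s h + i) - s]; as [i < s], copies are ranked by [h]
    first and by [i] second. *)
Definition weight v := \sum_(i < s) (s * (v i * v i) + 2 * (i * v i)).

(* Every copy of another variable in v comes before the next copy of x_i. *)
Definition below v (i : 'I_s) :=
  forall j : 'I_s, 0 < v j -> j != i -> s * v j + j < s * (v i).+1 + i.

(** Trading one copy of [x_j] in [v] for a copy of [x_i] taken from [r] must not lower the
    weight. *)
Lemma weight_min_below v r (i : 'I_s) :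
    (forall u, (u <= v + r)%MM -> mdeg u = mdeg v -> weight v <= weight u) ->
  0 < r i -> below v i.
Proof.
move=> vmin ri j vj ji.
pose u := (v - U_(j) + U_(i))%MM.
have ui : u i = (v i).+1 by rewrite !(mnmDE, mnmBE, mnm1E) eqxx (negbTE ji); lia.
have uj : u j = (v j).-1.
  by rewrite !(mnmDE, mnmBE, mnm1E) eqxx (eq_sym i) (negbTE ji); lia.
have uk k : k != i -> k != j -> u k = v k.
  rewrite !(mnmDE, mnmBE, mnm1E) !(eq_sym _ k) => /negbTE -> /negbTE ->; lia.
have /vmin : (u <= v + r)%MM.
  apply/mnm_lepP => k; rewrite mnmDE.
  have [->|ki] := eqVneq k i; first by lia.
  by have [->|kj] := eqVneq k j; [lia | rewrite uk //; lia].
have du : mdeg u = mdeg v.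
  rewrite !mdegE (bigD1 i) // (bigD1 j) //= ui uj.
  rewrite [RHS](bigD1 i) // [in RHS](bigD1 j) //=.
  rewrite (eq_bigr (fun k => v k)); first by lia.
  by move=> k /andP[ki kj]; apply: uk.
have wE w : weight w = s * (w i * w i) + 2 * (i * w i) +
    (s * (w j * w j) + 2 * (j * w j) +
     \sum_(k < s | (k != i) && (k != j)) (s * (w k * w k) + 2 * (k * w k))).
  by rewrite /weight (bigD1 i) // (bigD1 j).
move/(_ du); rewrite !wE ui uj [X in _ <= _ + (_ + X)](eq_bigr
  (fun k : 'I_s => s * (v k * v k) + 2 * (k * v k))).
  have nij : (j : nat) != i by [].
  have := ltn_ord i; have := ltn_ord j; move: nij.
  case: (v j) vj => // y _ /=; set S := bigop _ _ _; move: (v i) S => x S.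
  move: (i : nat) (j : nat) => a b ab bs as_ le.
  have {}le : s * y.+1 + b <= s * x.+1 + a by nia.
  (* The inequality is strict because the two sides have different residues modulo [s]. *)
  suff : s * y.+1 + b <> s * x.+1 + a by lia.
  by move=> eq; have := congr1 (modn^~ s) eq; rewrite !(mulnC s) !modnMDl !modn_small //; lia.
by move=> k /andP[ki kj]; rewrite uk.
Qed.

(** A converse, with uniqueness of the minimum. The hypothesis sees only the support of [r], which
    is what later reduces everything to pairs of variables. *)
Lemma below_weight_min v r :
    (forall i : 'I_s, 0 < r i -> below v i) ->
  forall u, (u <= v + r)%MM -> mdeg u = mdeg v -> u != v -> weight v < weight u.
Proof.
move=> vr u /mnm_lepP ur du uv.
have [j0 vj0] : exists j, 0 < v j.
  have [v0|] := eqVneq v 0%MM.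
    by case/eqP: uv; apply/eqP; rewrite v0 -mdeg_eq0 du v0 mdeg0.
  rewrite -mdeg_eq0 -lt0n mdegE lt0n sum_nat_eq0 negb_forall => /existsP[j vj].
  by exists j; rewrite lt0n.
case: (arg_maxnP (P := fun j : 'I_s => 0 < v j) (fun j : 'I_s => s * v j + j) vj0).
move=> jm vjm jmax {j0 vj0}; pose T := s * v jm + jm.
have lt_T (i : 'I_s) : v i < u i -> T < s * (v i).+1 + i.
  move=> vu; have [eji|nji] := eqVneq jm i; first by have := ltn_ord i; rewrite /T eji; nia.
  by apply: vr => //; have := ur i; rewrite mnmDE; lia.
(* The h-th copy of x_i has weight 2 (s h + i) - s, and T is the largest value
   of s h + i on the copies in v: each copy gained by u costs more than 2 T - s
   and each copy lost by u saves at most 2 T - s. *)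
have step (i : 'I_s) : s * (v i * v i) + 2 * (i * v i) + (2 * T * u i + s * v i) + (v i < u i)
    <= s * (u i * u i) + 2 * (i * u i) + (2 * T * v i + s * u i).
  by apply: weight_exchange => [/jmax|/lt_T].
(* Equal degrees and [u != v] force some exponent to grow; there the exchange inequality is
   strict. *)
have [i0 vu0] : exists i, v i < u i.
  apply/existsP; apply: contraR uv; rewrite negb_exists => /forallP /= le_uv.
  have uv : (u <= v)%MM by apply/mnm_lepP => i; rewrite leqNgt.
  have := submK uv; move/(congr1 (@mdeg _)); rewrite mdegD du.
  by move/eqP; rewrite -[X in _ == X]add0n eqn_add2r mdeg_eq0 => /eqP vu0; rewrite -(submK uv) vu0 add0m.
have := @leq_sum _ (index_enum 'I_s) xpredT _ _ (fun i _ => step i).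
rewrite !big_split /= -!big_distrr /= -!mdegE du.
have : 0 < \sum_i (v i < u i) by rewrite (bigD1 i0) //= vu0.
rewrite /weight !big_split /= -!big_distrr /= => lt0 le_sum.
rewrite -(ltn_add2r (2 * T * mdeg v + s * mdeg v)).
apply: leq_trans _ le_sum; by rewrite -addn1 leq_add2l.
Qed.
End Weight.

(** * Sorting, and divisors of given degree *)

Lemma sorting_perm (N : nat) (f : 'I_N -> nat) :
  exists p : 'S_N, forall i j : 'I_N, i <= j -> f (p i) <= f (p j).
Proof.
pose r := relpre f leq; pose t := sort_tuple r (ord_tuple N).
have /tuple_permP [p pE] : perm_eq t (ord_tuple N).
  by rewrite /= perm_sort.
exists p => i j ij.
have tE k : tnth t k = p k.
  rewrite (tnth_nth k) pE -[LHS](tnth_nth k [tuple _ | i < N]) tnth_mktuple.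
  by rewrite tnth_ord_tuple.
rewrite -!tE !(tnth_nth i).
have rt : transitive r by move=> ? ? ?; apply: leq_trans.
have rr : reflexive r by move=> ?; apply: leqnn.
have srt : sorted r t by apply: sort_sorted => ? ?; apply: leq_total.
by apply: (sorted_leq_nth rt rr i srt); rewrite ?inE ?size_tuple.
Qed.

Lemma divisor_of_mdeg (s d : nat) (m : 'X_{1..s}) :
  d <= mdeg m -> exists2 u, (u <= m)%MM & mdeg u = d.
Proof.
elim: d => [|d IHd] dm.
  by exists 0%MM; [apply/mnm_lepP => i; rewrite mnm0E | rewrite mdeg0].
have [u um ud] := IHd (ltnW dm).
have : (m - u)%MM != 0%MM.
  apply: contraL dm => /eqP mu; rewrite -leqNgt -ud -(submK um) mu add0m //.
rewrite -mdeg_eq0 mdegE sum_nat_eq0 negb_forall => /existsP[i /=].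
rewrite mnmBE => mui; exists (u + U_(i))%MM; last by rewrite mdegD mdeg1 ud addn1.
apply/mnm_lepP => j; rewrite mnmDE mnm1E; have := mnm_lepP um j.
by case: eqVneq => [<-|_]; lia.
Qed.

(** * Standard monomials *)

Section Standard.
Variables (s : nat) (V : zmodType) (a : 'I_s -> V).
Implicit Types m u : 'X_{1..s}.

(** The exponent vector of the image of a monomial. It serves for the points of A and for those of
    the dilation. *)
Definition mnm_image m : V := (\sum_(j < s) a j *+ m j)%R.

Local Notation image := mnm_image.

Lemma imageD m u : image (m + u)%MM = (image m + image u)%R.
Proof.
rewrite -big_split /=; apply: eq_bigr => j _.
by rewrite mnmDE mulrnDr.
Qed.

Lemma image1 i : image U_(i)%MM = a i.
Proof.
rewrite /mnm_image (bigD1 i) //= mnm1E eqxx mulr1n big1 ?addr0 // => j ji.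
by rewrite mnm1E eq_sym (negbTE ji) mulr0n.
Qed.

Definition nonstandard m := exists2 u, image u = image m & (u < m)%O.

(** Multiplying both monomials by [u - m] keeps their images equal and their order strict. *)
Lemma nonstandard_lepm m u : (m <= u)%MM -> nonstandard m -> nonstandard u.
Proof.
move=> mu [m' em ltm]; exists (u - m + m')%MM.
  by rewrite -[in RHS](submK mu) !imageD em.
by rewrite -[X in (_ < X)%O](submK mu) ltmc_add2r.
Qed.

Lemma standard_exists m : exists2 u, image u = image m & ~ nonstandard u.
Proof.
elim/(@ltmwf s): m => m IHm.
have [[u um ltum]|] := classic (nonstandard m); last by exists m.
by have [v vu nv] := IHm u ltum; exists v; rewrite // vu.
Qed.

Lemma standard_le m u : ~ nonstandard m -> image m = image u -> (m <= u)%O.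
Proof. by move=> nm mu; rewrite leNgt; apply/negP => um; apply: nm; exists u. Qed.

Lemma standard_inj m u :
  ~ nonstandard m -> ~ nonstandard u -> image m = image u -> m = u.
Proof. by move=> nm nu mu; apply/le_anti/andP; split; apply: standard_le. Qed.

Lemma nonstandard_truncation :
  exists b, forall m, nonstandard m -> nonstandard [multinom minn (m i) b | i < s].
Proof. exact/upset_truncation/nonstandard_lepm. Qed.

End Standard.

(** * The term order *)

Section Blocks.
Variables (s N : nat) (V : zmodType) (a : 'I_s -> V) (x : 'I_N -> V).
(** [st i] is the standard monomial of variable [i], [p] lists the variables by increasing weight,
    and [b] is the truncation bound; [s * b <= d] is how large [d] has to be. *)
Variables (b d : nat) (st : 'I_N -> 'X_{1..s}) (p : 'S_N).
Local Notation image := (mnm_image a).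
Local Notation nonstandard := (nonstandard a).
Hypothesis d_gt0 : 0 < d.
Hypothesis sb_le : s * b <= d.
Hypothesis image_mdeg : forall m u, image m = image u -> mdeg m = mdeg u.
Hypothesis bP : forall m, nonstandard m -> nonstandard [multinom minn (m i) b | i < s].
Hypothesis x_inj : injective x.
Hypothesis x_surj : forall m, mdeg m = d -> exists i, x i = image m.
Hypothesis st_image : forall i, image (st i) = x i.
Hypothesis st_mdeg : forall i, mdeg (st i) = d.
Hypothesis st_std : forall i, ~ nonstandard (st i).
Hypothesis p_sorted : forall i j : 'I_N, i <= j -> weight (st (p i)) <= weight (st (p j)).
Implicit Types w : 'X_{1..N}.

Lemma st_inj : injective st.
Proof. by move=> i j eq; apply: x_inj; rewrite -!st_image eq. Qed.

Definition expand w : 'X_{1..s} := [multinom \sum_k w k * st k i | i < s].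

Lemma expandD w w' : expand (w + w') = (expand w + expand w')%MM.
Proof.
apply/mnmP => i; rewrite mnmDE !mnmE -big_split; apply: eq_bigr => k _.
by rewrite mnmDE mulnDl.
Qed.

Lemma expand0 : expand 0%MM = 0%MM.
Proof. by apply/mnmP => i; rewrite !mnmE big1 // => k _; rewrite mnm0E. Qed.

Lemma expand1 k : expand U_(k)%MM = st k.
Proof.
apply/mnmP => i; rewrite mnmE (bigD1 k) //= big1 ?mnm1E ?eqxx ?mul1n ?addn0 //.
by move=> j jk; rewrite mnm1E eq_sym (negbTE jk).
Qed.

Lemma mdeg_expand w : mdeg (expand w) = mdeg w * d.
Proof.
rewrite mdegE; under eq_bigr do rewrite mnmE.
rewrite exchange_big mdegE big_distrl; apply: eq_bigr => k _ /=.
by rewrite -big_distrr -mdegE st_mdeg.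
Qed.

Lemma image_expand w : image (expand w) = mnm_image x w.
Proof.
rewrite /mnm_image; under eq_bigr do rewrite mnmE -sumrMnr.
rewrite exchange_big; apply: eq_bigr => k _.
rewrite -st_image -sumrMnl; apply: eq_bigr => j _.
by rewrite mulnC mulrnA.
Qed.

Definition permute w := [multinom w (p i) | i < N].

Lemma permuteD w w' : permute (w + w') = (permute w + permute w')%MM.
Proof. by apply/mnmP => i; rewrite !mnmE. Qed.

Lemma permute_inj : injective permute.
Proof. exact: mperm_inj. Qed.

Lemma mdeg_permute w : mdeg (permute w) = mdeg w.
Proof. exact: mdeg_mperm. Qed.

(** The second comparison is reversed: among monomials with one expansion, those richer in light
    variables are smaller. They all have the same degree, so the reversal still gives a term
    order. *)
Definition block_le w w' :=
  (expand w < expand w')%O ||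
  (expand w == expand w') && (permute w' <= permute w)%O.

Lemma block_le_expand w w' : block_le w w' -> (expand w <= expand w')%O.
Proof. by case/orP=> [/ltW|/andP[/eqP-> _]]. Qed.

Lemma expand_eq_mdeg w w' : expand w = expand w' -> mdeg w = mdeg w'.
Proof.
move/(congr1 (@mdeg s)); rewrite !mdeg_expand => /eqP.
by rewrite eqn_pmul2r // => /eqP.
Qed.

Lemma block_le_term_order : is_term_order block_le.
Proof.
split.
- move=> w w' /andP[ww' w'w]; have e : expand w = expand w'.
    by apply/le_anti; rewrite !block_le_expand.
  move: ww' w'w; rewrite /block_le e ltxx eqxx /= => h1 h2.
  by apply/permute_inj/le_anti; rewrite h1 h2.
- move=> w' w w'' /orP[lt|/andP[/eqP e le]] ww''.
    by rewrite /block_le (lt_le_trans lt (block_le_expand ww'')).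
  move: ww''; rewrite /block_le e => /orP[-> //|/andP[-> le']] /=.
  by rewrite (le_trans le' le) orbT.
- move=> w w'; rewrite /block_le [expand w' == _]eq_sym.
  case: ltgtP => //= _. exact: le_total.
- move=> w; rewrite /block_le expand0.
  have [e|ne] := eqVneq (expand w) 0%MM; last first.
    by rewrite lt_neqAle eq_sym ne le0x.
  have -> : w = 0%MM.
    by apply/eqP; rewrite -mdeg_eq0 (@expand_eq_mdeg w 0%MM) ?mdeg0 ?expand0.
  by rewrite lexx orbT.
- move=> w w1 w2; rewrite /block_le !expandD !permuteD ltmc_add2l eqm_add2r.
  by rewrite lemc_add2l.
Qed.

(** Divisors of standard monomials are standard, and a standard monomial is determined by its
    image. *)
Lemma standard_divisor m u :
  ~ nonstandard m -> (u <= m)%MM -> mdeg u = d -> exists k, st k = u.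
Proof.
move=> nm um ud; have [k xk] := x_surj ud; exists k.
apply: (standard_inj (st_std (i := k))).
  by move/(nonstandard_lepm um).
by rewrite st_image.
Qed.

(** * Monomials that no quadratic binomial reduces *)

Section Reduced.
Variable w : 'X_{1..N}.

Definition reduced := forall i j k l, (U_(i) + U_(j) <= w)%MM ->
  (x i + x j = x k + x l)%R -> block_le (U_(i) + U_(j))%MM (U_(k) + U_(l))%MM.

Hypothesis w_reduced : reduced.

(** The standard monomial with the same image has degree [2 d] and splits into two standard factors
    of degree [d], that is, into two variables. Their product would be smaller. *)
Lemma reduced_pair_standard i j :
  (U_(i) + U_(j) <= w)%MM -> ~ nonstandard (st i + st j)%MM.
Proof.
move=> ijw [u0 u0e lt0].
have [m me nm] := standard_exists a (st i + st j)%MM.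
have dm : mdeg m = d + d by rewrite (image_mdeg me) mdegD !st_mdeg.
have [|u um ud] := @divisor_of_mdeg s d m; first by lia.
have [k ku] := standard_divisor nm um ud.
have [|l lu] := standard_divisor nm (lem_subr m u).
  by have := submK um; move/(congr1 (@mdeg s)); rewrite mdegD dm ud; lia.
have e : (st k + st l)%MM = m by rewrite ku lu addmC submK.
have := w_reduced (k := k) (l := l) ijw.
rewrite -!st_image -!imageD e me => /(_ erefl)/block_le_expand.
rewrite !expandD !expand1 e => ijm.
by apply: nm; exists u0; [rewrite me | apply: lt_le_trans ijm].
Qed.

(** A lighter divisor [u] and its cofactor are again standard, hence variables [k] and [l] with the
    same expansion. As [k] is lighter than [i] and [j], their product would be smaller. *)
Lemma reduced_pair_min i j u :
    (U_(i) + U_(j) <= w)%MM -> weight (st i) <= weight (st j) ->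
    (u <= st i + st j)%MM -> mdeg u = d ->
  weight (st i) <= weight u.
Proof.
move=> ijw ij uij ud; rewrite leqNgt; apply/negP => ui.
have nm := reduced_pair_standard ijw.
have [k ku] := standard_divisor nm uij ud.
have [|l lu] := standard_divisor nm (lem_subr _ u).
  by have := submK uij; move/(congr1 (@mdeg s)); rewrite !mdegD !st_mdeg ud; lia.
have e : (st k + st l)%MM = (st i + st j)%MM by rewrite ku lu addmC submK.
have := w_reduced (k := k) (l := l) ijw.
rewrite -!st_image -!imageD e => /(_ erefl).
rewrite /block_le !expandD !expand1 e ltxx eqxx /=.
pose t := (p^-1)%g k.
have kt k' : weight (st k') <= weight (st k) -> (k' != i) && (k' != j).
  by move=> h; apply/andP; split; apply/eqP => E; move: h; rewrite E ku; lia.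
have /andP[ki kj] := kt k (leqnn _).
rewrite le_eqVlt => /orP[/eqP|].
  move/mnmP/(_ t); rewrite !(mnmE, mnmDE, mnm1E) permKV eqxx.
  by rewrite !(eq_sym _ k) (negbTE ki) (negbTE kj).
move/ltmcP; case; first by rewrite !mdeg_permute !mdegD !mdeg1.
move=> t' agree; have [tt' _|t't lt_t'] := ltnP t t'.
  have := agree _ tt'; rewrite !(mnmE, mnmDE, mnm1E) permKV eqxx.
  by rewrite !(eq_sym _ k) (negbTE ki) (negbTE kj).
(* A first difference at or before the position of [k] would have to come from [i] or [j], which are
   both heavier than [k]. *)
have : weight (st (p t')) <= weight (st k).
  by rewrite -[k](permKV p) p_sorted.
move/kt => /andP[ni nj]; move: lt_t'; rewrite !(mnmE, mnmDE, mnm1E).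
by rewrite !(eq_sym _ (p t')) (negbTE ni) (negbTE nj).
Qed.

(** A variable [x_t] of the cofactor already occurs in a single factor [st k], so minimality for the
    pair [i], [k] suffices. If [k = i], then [w0] contains [i] twice. *)
Lemma reduced_below w0 i :
    (w0 <= w)%MM -> 0 < w0 i ->
    (forall k, 0 < w0 k -> weight (st i) <= weight (st k)) ->
  forall t, 0 < expand (w0 - U_(i))%MM t -> below (st i) t.
Proof.
move=> w0w w0i imin t; rewrite mnmE lt0n sum_nat_eq0 negb_forall.
case/existsP => k; rewrite implyTb muln_eq0 negb_or mnmBE mnm1E -!lt0n => /andP[wk kt].
have ikw : (U_(i) + U_(k) <= w)%MM.
  apply: lepm_trans w0w; apply/mnm_lepP => j; rewrite mnmDE !mnm1E.
  move: wk w0i; have [->|nik] := eqVneq i k.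
    by have [->|] := eqVneq k j; lia.
  have [<-|_] := eqVneq i j; last by have [->|] := eqVneq k j; lia.
  by rewrite eq_sym (negbTE nik) addn0.
apply: weight_min_below kt => u uik ud.
apply: reduced_pair_min ikw _ uik _; last by rewrite ud st_mdeg.
by apply: imin; move: wk; lia.
Qed.

Lemma min_weight_block w0 : w0 != 0%MM ->
  exists2 i, 0 < w0 i & forall k, 0 < w0 k -> weight (st i) <= weight (st k).
Proof.
rewrite -mdeg_eq0 mdegE sum_nat_eq0 negb_forall => /existsP[i0]; rewrite -lt0n => wi0.
by case: (arg_minnP (P := fun i => 0 < w0 i) (fun i => weight (st i)) wi0) => i; exists i.
Qed.

Lemma expand_split w0 i : 0 < w0 i ->
  expand w0 = (st i + expand (w0 - U_(i)))%MM.
Proof.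
rewrite lt0n -lep1mP => iw; by rewrite -[in LHS](submK iw) expandD expand1 addmC.
Qed.

Lemma reduced_standard : ~ nonstandard (expand w).
Proof.
have [->|/min_weight_block[i wi imin]] := eqVneq w 0%MM.
  by rewrite expand0 => -[u _]; rewrite ltNge le0x.
have ibelow := reduced_below (lepm_refl w) wi imin.
rewrite (expand_split wi); move: (expand _) ibelow => r ibelow /bP.
move=> nst; apply: (@st_std i); apply: nonstandard_lepm nst.
(* If [st i] had too few copies of [x_t], its exponent there would be below [b] and all its others
   at most [b], so its degree would be below [s * b <= d]. *)
apply/mnm_lepP => t; rewrite mnmE mnmDE leqNgt; apply/negP => lt_t.
have rt : 0 < r t by lia.
have vt : st i t < b by lia.
have := leqnn d; rewrite -[X in _ <= X](st_mdeg i) mdegE; apply/negP; rewrite -ltnNge.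
have sbE : s * b = b + \sum_(j < s | j != t) b.
  by rewrite -[s in LHS]card_ord -sum_nat_const (bigD1 t).
apply: leq_trans _ sb_le; rewrite (bigD1 t) //= sbE -addSn leq_add // leq_sum // => j jt.
have [->//|stj] := posnP (st i j).
have {}ibelow := ibelow t rt j stj jt.
have : s * st i j < s * (st i t).+2.
  by rewrite (mulnS s _.+1); have := ltn_ord t; lia.
by rewrite ltn_mul2l => /andP[_]; lia.
Qed.

(** Standardness of [expand w] settles the first comparison. If the expansions agree, the second one
    follows from uniqueness of the lightest divisor. *)
Lemma reduced_least w' :
  mnm_image x w = mnm_image x w' -> block_le w w'.
Proof.
rewrite -!image_expand => ww'.
have := standard_le reduced_standard ww'; rewrite /block_le le_eqVlt orbC.
case/orP => [-> //|/eqP e]; rewrite e eqxx /=; apply/orP; right.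
rewrite leNgt; apply/negP => /ltmcP[|t agree lt_t].
  by rewrite !mdeg_permute (expand_eq_mdeg e).
pose q := (p^-1)%g; pose i0 := p t.
(* [t] is the first difference. Cancelling what [w] and [w'] share up to it leaves [w0], supported
   after [t], and [w0'], which contains [i0], with the same expansion. *)
pose w0 := [multinom (if t < q k then w k else 0) | k < N].
pose w0' := [multinom (if t < q k then w' k else if k == i0 then w' k - w k else 0) | k < N].
have ww0 : (w + w0' = w' + w0)%MM.
  apply/mnmP => k; rewrite !mnmDE !mnmE.
  have kE : k = p (q k) by rewrite permKV.
  case: ltngtP => [tk|kt|/val_inj tk]; first by rewrite addnC.
    have := agree _ kt; rewrite !mnmE -kE => ->.
    by case: eqVneq => // E; move: kt; rewrite E /q permK ltnn.
  move: lt_t; rewrite !mnmE {1 2}tk -kE /i0 tk -kE eqxx; lia.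
have ew0 : expand w0' = expand w0.
  by move/(congr1 expand): ww0; rewrite !expandD e => /addmI.
have w0'i0 : 0 < w0' i0.
  by rewrite mnmE /q permK ltnn eqxx subn_gt0; move: lt_t; rewrite !mnmE.
have /min_weight_block[i w0i imin] : w0 != 0%MM.
  rewrite -mdeg_eq0 -(expand_eq_mdeg ew0) mdeg_eq0.
  by apply: contraL w0'i0 => /eqP->; rewrite mnm0E.
have w0w : (w0 <= w)%MM by apply/mnm_lepP => k; rewrite mnmE; case: ifP.
have tqi : t < q i by move: w0i; rewrite mnmE; case: ifP.
(* The lightest variable [i] of [w0] would be strictly lighter than [i0], which [p] lists
   earlier. *)
have := below_weight_min (reduced_below w0w w0i imin) (u := st i0).
rewrite -(expand_split w0i) !st_mdeg -ew0 (expand_split w0'i0) lem_addr.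
move=> /(_ isT erefl); rewrite (inj_eq st_inj).
have -> : i0 != i by apply: contraL tqi => /eqP <-; rewrite /q permK ltnn.
by move/(_ isT); rewrite ltnNge -[i](permKV p) p_sorted // ltnW.
Qed.

End Reduced.
End Blocks.

(** * Toric ideals *)

Section IdealGenerated.
Variable R : comNzRingType.
Implicit Types (S : R -> Prop) (y z : R).
Local Open Scope ring_scope.

Lemma ideal_generatedD S y z :
  ideal_generated S y -> ideal_generated S z -> ideal_generated S (y + z).
Proof.
move=> [r [rS ->]] [t [tS ->]]; exists (r ++ t); rewrite big_cat; split=> // c.
by rewrite mem_cat => /orP[/rS|/tS].
Qed.

Lemma ideal_generatedM S y z : ideal_generated S z -> ideal_generated S (y * z).
Proof.
move=> [r [rS ->]]; exists [seq (y * c.1, c.2) | c <- r].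
split=> [_ /mapP[c /rS Sc ->] //|]; rewrite big_map mulr_sumr.
by apply: eq_bigr => c _; rewrite mulrA.
Qed.

Lemma ideal_generated_sub S T y :
    (forall z, S z -> ideal_generated T z) ->
  ideal_generated S y -> ideal_generated T y.
Proof.
move=> ST [r [rS ->]]; elim: r rS => [|c r IHr] rS.
  by exists nil; rewrite !big_nil.
rewrite big_cons; apply: ideal_generatedD.
  by apply/ideal_generatedM/ST/rS/mem_head.
by apply: IHr => c' rc'; apply: rS; rewrite inE rc' orbT.
Qed.

Lemma mem_ideal_generated S y : S y -> ideal_generated S y.
Proof.
move=> Sy; exists [:: (1, y)]; rewrite big_seq1 mul1r; split=> // c.
by rewrite inE => /eqP ->.
Qed.

End IdealGenerated.

Definition point (n : nat) (A : {fset 'rV[int]_n}) (i : 'I_#|` A|) : 'rV[int]_n :=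
  ((enum_fset A)`_i)%R.
Arguments point {n} A i.

(** * The kernel of the toric map *)

Section ToricKernel.
Variables (K : fieldType) (n : nat).
Local Open Scope ring_scope.
Implicit Types v : 'rV[int]_n.

Local Notation laurent := (laurent_monomial K).

Lemma laurent_monomialD v v' : laurent (v + v') = laurent v * laurent v'.
Proof.
rewrite -big_split; apply: eq_bigr => j _.
by rewrite mxE expfzDr // tofrac_eq0 -msupp_eq0 msuppX.
Qed.

Lemma laurent_monomial0 : laurent (0 : 'rV_n) = 1.
Proof. by rewrite /laurent_monomial big1 // => j _; rewrite mxE. Qed.

Lemma laurent_monomialMn v k : laurent (v *+ k) = laurent v ^+ k.
Proof.
by elim: k => [|k IHk]; rewrite ?laurent_monomial0 // mulrS laurent_monomialD IHk exprS.
Qed.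

Lemma laurent_monomial_sum (I : finType) (f : I -> 'rV[int]_n) :
  laurent (\sum_i f i) = \prod_i laurent (f i).
Proof. exact: (big_morph _ laurent_monomialD laurent_monomial0). Qed.

Lemma laurent_monomial_nat (m : 'X_{1..n}) :
  laurent (\row_j (m j)%:Z) = tofrac 'X_[m].
Proof.
rewrite mpolyXE_id rmorph_prod; apply: eq_bigr => j _.
by rewrite mxE rmorphXn.
Qed.

Variable A : {fset 'rV[int]_n}.
Local Notation exponent := (mnm_image (point A)).

Lemma toric_mapX (u : 'X_{1..#|` A|}) : toric_map K A 'X_[u] = laurent (exponent u).
Proof.
rewrite /toric_map mmapX /mmap1 laurent_monomial_sum.
by apply: eq_bigr => i _; rewrite laurent_monomialMn.
Qed.

Lemma toric_mapE p : toric_map K A p =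
  \sum_(u <- msupp p) tofrac (p@_u)%:MP * laurent (exponent u).
Proof.
rewrite {1}[p]mpolyE /toric_map raddf_sum; apply: eq_bigr => u _.
by rewrite /= mmapZ; congr (_ * _); apply: toric_mapX.
Qed.

Lemma toric_ideal_binomial u u' :
  exponent u = exponent u' -> toric_ideal K A ('X_[u] - 'X_[u']).
Proof.
move=> e; rewrite /toric_ideal /toric_map raddfB /=.
by have := toric_mapX u; have := toric_mapX u'; rewrite /toric_map => -> ->; rewrite e subrr.
Qed.

(** Distinct Laurent monomials are linearly independent, so a term of a kernel element cannot be
    alone with its image. Clearing denominators reduces this to comparing coefficients of a
    polynomial. *)
Lemma toric_ideal_msupp p u : toric_ideal K A p -> u \in msupp p ->
  exists2 u', u' \in msupp p & u' != u /\ exponent u' = exponent u.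
Proof.
rewrite /toric_ideal toric_mapE => p0 up.
have [/hasP[u' u'p /andP[u'u /eqP e]]|/hasPn nu] :=
  boolP (has (fun u' => (u' != u) && (exponent u' == exponent u)) (msupp p)).
  by exists u'.
(* The sum of all absolute values dominates each exponent, so every shifted exponent is a natural
   number. *)
pose shift := [multinom (\sum_(u' <- msupp p) absz (exponent u' 0%R j))%N | j < n].
pose e u' := [multinom absz (exponent u' 0%R j + (shift j)%:Z)%R | j < n].
have eE u' : u' \in msupp p ->
    exponent u' + \row_j (shift j)%:Z = \row_j (e u' j)%:Z.
  move=> u'p; apply/rowP => j; rewrite !mxE !mnmE.
  rewrite (big_rem u') //=; lia.
have : \sum_(u' <- msupp p) p@_u' *: 'X_[e u'] = 0 :> {mpoly K[n]}.
  apply/eqP; rewrite -tofrac_eq0 raddf_sum /=; apply/eqP.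
  transitivity ((\sum_(u' <- msupp p) tofrac (p@_u')%:MP * laurent (exponent u')) *
      laurent (\row_j (shift j)%:Z)); last by rewrite p0 mul0r.
  rewrite mulr_suml [LHS]big_seq [RHS]big_seq; apply: eq_bigr => u' u'p.
  rewrite -mulrA -laurent_monomialD eE // laurent_monomial_nat.
  by rewrite -mul_mpolyC rmorphM.
move/(congr1 (mcoeff (e u))); rewrite raddf_sum mcoeff0 /=.
rewrite (bigD1_seq u) ?msupp_uniq //= mcoeffZ mcoeffX eqxx mulr1.
rewrite big_seq_cond big1 ?addr0.
  by move/eqP; rewrite mcoeff_eq0 up.
move=> u' /andP[u'p u'u]; rewrite mcoeffZ mcoeffX; case: eqP => [eu|]; last by rewrite mulr0.
have := nu _ u'p; rewrite u'u /= => /eqP[].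
by apply: (addIr (\row_j (shift j)%:Z)); rewrite !eE // eu.
Qed.

End ToricKernel.

(** * Points of the dilated configuration *)

Section Dilation.
Variables (n : nat) (A : {fset 'rV[int]_n}) (d : nat).
Local Open Scope ring_scope.

Lemma sum_fset_ord (F : 'rV[int]_n -> nat -> 'rV[int]_n) (g : 'rV[int]_n -> nat) :
  \sum_(i : A) F (val i) (g (val i)) =
  \sum_(j < #|` A|) F (point A j) (g (point A j)).
Proof.
by rewrite -(big_seq_fsetE _ A xpredT (fun v => F v (g v))) (big_nth 0) big_mkord.
Qed.

Lemma sum_fset_ord_nat (g : 'rV[int]_n -> nat) :
  (\sum_(i : A) g (val i) = \sum_(j < #|` A|) g (point A j))%N.
Proof. by rewrite -(big_seq_fsetE _ A xpredT g) (big_nth 0%R) big_mkord. Qed.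

(** The function [g] on vectors mediates between coefficients indexed by the elements of [A] and
    exponents indexed by ordinals. *)
Lemma dilateP v : reflect
  (exists2 m, mdeg m = d & v = mnm_image (point A) m)
  (v \in dilate A d).
Proof.
apply: (iffP idP) => [/imfsetP[a /= ad ->]|[m md ->]].
  pose g u : nat := if insub u is Some i then a i else 0%N.
  have gE (i : A) : g (val i) = a i by rewrite /g valK.
  exists [multinom g (point A j) | j < #|` A|].
    rewrite mdegE; under eq_bigr do rewrite mnmE.
    rewrite -sum_fset_ord_nat; under eq_bigr do rewrite gE.
    by apply/eqP.
  rewrite /mnm_image; under [RHS]eq_bigr do rewrite mnmE.
  rewrite -(sum_fset_ord (fun u k => u *+ k) g).
  by apply: eq_bigr => i _; rewrite gE.
pose g u := nth 0%N m (index u (enum_fset A)).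
have gE (j : 'I_#|` A|) : g (point A j) = m j.
  by rewrite /g /point index_uniq ?enum_fset_uniq // -mnm_nth.
have gsum : (\sum_(i : A) g (val i) = d)%N.
  by rewrite sum_fset_ord_nat -md mdegE; apply: eq_bigr => j _; rewrite gE.
have g_le (i : A) : (g (val i) < d.+1)%N.
  by rewrite ltnS -gsum (bigD1 i) //= leq_addr.
apply/imfsetP; exists [ffun i : A => inord (g (val i)) : 'I_d.+1] => /=.
  rewrite unfold_in /= -[X in _ == X]gsum; apply/eqP; apply: eq_bigr => i _.
  by rewrite ffunE inordK ?g_le.
have -> : mnm_image (point A) m = \sum_j point A j *+ g (point A j).
  by apply: eq_bigr => j _; rewrite gE.
rewrite -(sum_fset_ord (fun u k => u *+ k) g).
by apply: eq_bigr => i _; rewrite ffunE inordK ?g_le.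
Qed.

(** The functional given by [lambda] is 1 at each point, so it reads off the degree from the
    image. *)
Lemma configuration_mdeg : is_configuration A ->
  forall m u, mnm_image (point A) m = mnm_image (point A) u -> mdeg m = mdeg u.
Proof.
move=> [lambda [_ lambdaP]] m u /=.
pose L (v : 'rV[int]_n) : rat := \sum_(j < n) lambda 0 j * (v 0 j)%:~R.
have LD v v' : L (v + v') = L v + L v'.
  rewrite -big_split; apply: eq_bigr => j _.
  by rewrite mxE rmorphD mulrDr.
have L0 : L 0 = 0 by rewrite /L big1 // => j _; rewrite mxE mulr0.
have LMn v k : L (v *+ k) = L v *+ k.
  by elim: k => [|k IHk]; rewrite ?L0 // !mulrS LD IHk.
have Lsum w : L (mnm_image (point A) w) = (mdeg w)%:R.
  rewrite /mnm_image (big_morph L LD L0) mdegE natr_sum; apply: eq_bigr => j _.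
  by rewrite LMn /L lambdaP ?mem_nth //.
by move/(congr1 L); rewrite !Lsum => /eqP; rewrite Num.Theory.eqr_nat => /eqP.
Qed.

End Dilation.

(** * A criterion for a quadratic Gröbner basis *)

Section QuadraticBasis.
Variables (K : fieldType) (n : nat) (D : {fset 'rV[int]_n}).
Local Open Scope ring_scope.
Local Notation N := #|` D|.
Local Notation exponent := (mnm_image (point D)).
Variable le : rel 'X_{1..N}.

Definition quadrics : seq {mpoly K[N]} :=
  [seq 'X_[U_(t.1.1) + U_(t.1.2)] - 'X_[U_(t.2.1) + U_(t.2.2)]
     | t <- enum {: ('I_N * 'I_N) * ('I_N * 'I_N)}
     & exponent (U_(t.1.1) + U_(t.1.2)) == exponent (U_(t.2.1) + U_(t.2.2))].

Lemma mem_quadrics i j k l :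
  exponent (U_(i) + U_(j)) = exponent (U_(k) + U_(l)) ->
  'X_[U_(i) + U_(j)] - 'X_[U_(k) + U_(l)] \in quadrics.
Proof.
move=> e; apply/mapP; exists ((i, j), (k, l)) => //.
by rewrite mem_filter mem_enum andbT; apply/eqP.
Qed.

Lemma quadrics_toric g : g \in quadrics -> toric_ideal K D g.
Proof.
case/mapP => t; rewrite mem_filter => /andP[/eqP e _] ->.
exact: toric_ideal_binomial.
Qed.

Lemma quadrics_homog g : g \in quadrics -> g \is 2.-homog.
Proof.
by case/mapP => t _ ->; apply: rpredB; rewrite dhomogX /= mdegD !mdeg1.
Qed.

Lemma initial_binomial u v : reflexive le -> ~~ le u v -> total le ->
  is_initial_monomial le ('X_[u] - 'X_[v] : {mpoly K[N]}) u.
Proof.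
move=> le_refl nuv le_total.
have uv : v != u by apply: contraNneq nuv => ->.
split=> [|m' /msuppB_le].
  by rewrite mcoeff_msupp mcoeffB !mcoeffX eqxx (negbTE uv) subr0 oner_neq0.
rewrite mem_cat !msuppX !inE => /orP[]/eqP-> //.
by have := le_total u v; rewrite (negbTE nuv).
Qed.

(** An initial monomial [w] of a kernel element shares its image with a different monomial [w'] of
    that element, and [w'] is smaller. So [w] is not least in its fibre, and the initial monomial of
    some quadric divides it. *)
Lemma quadratic_groebner_basis :
    is_term_order le ->
    (forall w w', exponent w = exponent w' ->
      (forall i j k l, (U_(i) + U_(j) <= w)%MM ->
         exponent (U_(i) + U_(j)) = exponent (U_(k) + U_(l)) ->
         le (U_(i) + U_(j))%MM (U_(k) + U_(l))%MM) ->
      le w w') ->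
  admits_quadratic_groebner_basis (toric_ideal K D).
Proof.
move=> ord least; have [anti trans tot _ _] := ord.
have refl : reflexive le by move=> u; have := tot u u; rewrite orbb.
exists le, quadrics; split=> // [|g gG]; last by exists 2; rewrite ?quadrics_homog.
split=> [|q]; first exact: quadrics_toric.
split; apply: ideal_generated_sub => _ [p [w [pI pw ->]]].
  by apply: mem_ideal_generated; exists p, w; split=> //; apply: quadrics_toric.
have [wp wmax] := pw; have [w' w'p [w'w e]] := toric_ideal_msupp pI wp.
have [|] := boolP [forall t : ('I_N * 'I_N) * ('I_N * 'I_N),
  (U_(t.1.1) + U_(t.1.2) <= w)%MM ==>
  (exponent (U_(t.1.1) + U_(t.1.2)) == exponent (U_(t.2.1) + U_(t.2.2))) ==>
  le (U_(t.1.1) + U_(t.1.2))%MM (U_(t.2.1) + U_(t.2.2))%MM].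
  move/forallP => red; case/eqP: w'w; apply: anti; rewrite wmax //=.
  apply: least => // i j k l ijw eij.
  by have /implyP/(_ ijw)/implyP/(_ (introT eqP eij)) := red ((i, j), (k, l)).
rewrite negb_forall => /existsP[[[i j] [k l]]] /=.
rewrite !negb_imply => /and3P[ijw /eqP eij nle].
rewrite -(submK ijw) mpolyXD; apply/ideal_generatedM/mem_ideal_generated.
exists ('X_[U_(i) + U_(j)] - 'X_[U_(k) + U_(l)]), (U_(i) + U_(j))%MM.
by split=> //; [apply: mem_quadrics | apply: initial_binomial].
Qed.

End QuadraticBasis.

Theorem mainTheorem1 (K : fieldType) (n : nat) (A : {fset 'rV[int]_n})
    (hA : is_configuration A) :
  exists d0 : nat, forall d : nat, (0 < d)%N -> (d0 <= d)%N ->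
    admits_quadratic_groebner_basis (toric_ideal K (dilate A d)).
Proof.
pose a := point A.
have image_mdeg := configuration_mdeg hA.
have [b bP] := nonstandard_truncation a.
(* The bound [b] depends on [A] alone, so this choice is uniform in [d]. *)
exists (#|` A| * b) => d d_gt0 sb_le.
pose N := #|` dilate A d|.
pose x := point (dilate A d).
have x_inj : injective x.
  move=> i j /eqP; rewrite nth_uniq ?fset_uniq ?ltn_ord // => /eqP; exact: val_inj.
have x_surj m : mdeg m = d -> exists i, x i = mnm_image a m.
  move=> md; have /(nthP 0%R)[i iN xi] : mnm_image a m \in dilate A d.
    by apply/dilateP; exists m.
  by exists (Ordinal iN).
(* Passing to the standard monomial keeps the degree [d] because [A] is a configuration. *)
have /fin_all_exists [st stP] : forall i, exists m,
    [/\ mnm_image a m = x i, mdeg m = d & ~ nonstandard a m].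
  move=> i; have /dilateP[m md xi] : x i \in dilate A d by apply: mem_nth.
  have [u um nu] := standard_exists a m; exists u; split=> //.
    by rewrite um xi.
  by rewrite (image_mdeg _ _ um).
have [p p_sorted] := sorting_perm (fun i => weight (st i)).
have st_image i : mnm_image a (st i) = x i by have [] := stP i.
have st_mdeg i : mdeg (st i) = d by have [] := stP i.
have st_std i : ~ nonstandard a (st i) by have [] := stP i.
apply: (@quadratic_groebner_basis _ _ _ (block_le st p)).
  exact: block_le_term_order d_gt0 st_mdeg.
move=> w w' e red.
apply: (reduced_least d_gt0 sb_le image_mdeg bP x_inj x_surj st_image st_mdeg st_std p_sorted) => //.
by move=> i j k l ijw eij; apply: red => //; rewrite !imageD !image1.
Qed.
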